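(* Let $\Gamma$ be an additive subgroup of $\mathbb{R}$, let $E$ be a finite set, and let $\mathsf{M}=(E,\nu_{\mathsf{M}})$ be a valuated matroid of rank $r$ on $E$ with values in $\overline{\Gamma}$. Let $\widetilde{\nu}_{\mathsf{M}}\colon\binom{E}{\leq r}\to\overline{\Gamma}$ be its extension defined by $\widetilde{\nu}_{\mathsf{M}}(S)=\min\{\nu_{\mathsf{M}}(B)\mid B\in\binom{E}{r},\ S\subseteq B\}$. Fix $0<q\leq 1$ and set $$I_k(\mathsf{M}):=\sum_{S\in\binom{E}{k}} q^{\widetilde{\nu}_{\mathsf{M}}(S)}\qquad (0\leq k\leq r),$$ with the convention $q^{\infty}=0$. Then for all $1\leq k<r$, $$I_k(\mathsf{M})^2\ \geq\ \frac{k+1}{k}\, I_{k+1}(\mathsf{M})\, I_{k-1}(\mathsf{M}).$$ In particular the sequence $(I_k(\mathsf{M}))_{k}$ is log-concave.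
   Context: $\overline{\Gamma}=\Gamma\sqcup\{\infty\}$ with $\infty$ larger than every element of $\Gamma$. For a finite set $E$ and an integer $r\ge 0$, $\binom{E}{r}$ (resp. $\binom{E}{\leq r}$) denotes the set of subsets of $E$ with exactly $r$ (resp. at most $r$) elements. A valuated matroid $\mathsf{M}$ of rank $r$ on $E$ is a map $\nu_{\mathsf{M}}\colon\binom{E}{r}\to\overline{\Gamma}$, not identically $\infty$, such that for all $S,T\in\binom{E}{r}$ and every $s\in S- T$ there exists $t\in T- S$ with $\nu_{\mathsf{M}}(S)+\nu_{\mathsf{M}}(T)\geq \nu_{\mathsf{M}}(S-\{s\}\cup\{t\})+\nu_{\mathsf{M}}(T-\{t\}\cup\{s\})$. *)

(* Defs.v *)
From HB Require Import structures.
From mathcomp Require Import all_boot all_order all_algebra.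
From mathcomp Require Import reals exp.
Set Implicit Arguments. Unset Strict Implicit. Unset Printing Implicit Defensive.
Import Order.TTheory GRing.Theory Num.Theory.
Local Open Scope ring_scope.

(* Gamma-bar = Gamma u {oo} is modelled as [option R]: [Some a] is the finite
   value a, [None] is +oo (larger than everything). *)
Section ValMat.
Variable R : realType.

Definition oadd (x y : option R) : option R :=
  match x, y with Some a, Some b => Some (a + b) | _, _ => None end.

Definition ole (x y : option R) : bool :=
  match x, y with
  | _, None => true
  | None, Some _ => false
  | Some a, Some b => a <= b
  end.

Definition omin (x y : option R) : option R := if ole x y then x else y.

Variable E : finType.

(* Valuated matroid of rank r on E with values in Gamma-bar, Gamma = G.
   nu is only used on r-subsets of E. *)
Definition valuated_matroid (G : {pred R}) (r : nat) (nu : {set E} -> option R) : Prop :=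
  (forall B : {set E}, #|B| = r -> forall a, nu B = Some a -> a \in G) /\
  (exists B : {set E}, #|B| = r /\ nu B <> None) /\
  (forall S T : {set E}, #|S| = r -> #|T| = r ->
     forall s, s \in S :\: T -> exists2 t, t \in T :\: S &
       ole (oadd (nu (t |: (S :\ s))) (nu (s |: (T :\ t))))
           (oadd (nu S) (nu T))).

Definition ext_nu (r : nat) (nu : {set E} -> option R) (S : {set E}) : option R :=
  \big[omin/None]_(B : {set E} | (#|B| == r) && (S \subset B)) nu B.

Definition qpow (q : R) (x : option R) : R :=
  match x with Some a => powR q a | None => 0 end.

Definition Ik (q : R) (r : nat) (nu : {set E} -> option R) (k : nat) : R :=
  \sum_(S : {set E} | #|S| == k) qpow q (ext_nu r nu S).
End ValMat.

(* Main.v *)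
(* Write [f S := q^(ext_nu S)] and complete the generating polynomial of [f] by a
   homogenizing variable [y], the monomial [x^S y^a] being divided by [a`!].  The
   quadratic derivatives of this polynomial along a set [S] are Lorentzian: taking
   the Schur complement at [y] turns this into the positivity of an ultrametric
   matrix, which is the three-term exchange property of the valuation.  The
   Lorentzian property then climbs to all degrees: the Hessian in degree [n + 1]
   is the sum of the slices of a symmetric tensor whose slices are Hessians in
   degree [n], and Bochner's method passes from the slices to the sum.  As [y] is
   connected to every non-loop no irreducibility issue arises.  All of this is done
   at the all-ones point; replacing [f S] by [t^#|S| f S] and letting [t] go to
   infinity amounts to letting [y] go to 0, and the Hessian inequality between the
   vectors [y] and [1_E] becomes the theorem. *)
Require Import Defs.
From HB Require Import structures.
From mathcomp Require Import all_boot all_order all_algebra.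
From mathcomp Require Import reals exp.
From mathcomp Require Import ring lra.
Import Order.TTheory GRing.Theory Num.Theory.
Local Open Scope ring_scope.

(** * Hyperbolic forms *)

Section Forms.
Context {R : realType} {I : finType}.
Implicit Types (M : I -> I -> R) (u v w : I -> R) (a b : R).

Definition mulmv M v : I -> R := fun i => \sum_j M i j * v j.

Definition form M u v : R := \sum_i u i * mulmv M v i.

(** The reversed Cauchy-Schwarz inequality: for symmetric [M] it amounts to having at most one
    positive eigenvalue. *)
Definition hyperbolic M : Prop :=
  forall u v, 0 <= form M u u -> form M u u * form M v v <= form M u v ^+ 2.

Definition comb a u b v : I -> R := fun i => a * u i + b * v i.

Lemma mulmv_comb M a u b v i :
  mulmv M (comb a u b v) i = a * mulmv M u i + b * mulmv M v i.
Proof.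
rewrite /mulmv !mulr_sumr -big_split /=; apply: eq_bigr => j _.
rewrite /comb; ring.
Qed.

Lemma form_combr M w a u b v :
  form M w (comb a u b v) = a * form M w u + b * form M w v.
Proof.
rewrite /form !mulr_sumr -big_split /=; apply: eq_bigr => i _.
rewrite mulmv_comb; ring.
Qed.

Lemma form_combl M w a u b v :
  form M (comb a u b v) w = a * form M u w + b * form M v w.
Proof.
rewrite /form !mulr_sumr -big_split /=; apply: eq_bigr => i _.
rewrite /comb; ring.
Qed.

Lemma formC M u v : (forall i j, M i j = M j i) -> form M u v = form M v u.
Proof.
move=> symM; rewrite /form /mulmv.
under eq_bigr do rewrite mulr_sumr.
under [RHS]eq_bigr do rewrite mulr_sumr.
rewrite exchange_big /=; apply: eq_bigr => i _; apply: eq_bigr => j _.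
rewrite symM; ring.
Qed.

Lemma form_comb2 M a u b v : (forall i j, M i j = M j i) ->
  form M (comb a u b v) (comb a u b v) =
  a ^+ 2 * form M u u + 2 * (a * b) * form M u v + b ^+ 2 * form M v v.
Proof.
move=> symM; rewrite form_combl !form_combr (formC _ v u) //; ring.
Qed.

Lemma eq_form {M M'} : (forall i j, M i j = M' i j) ->
  forall u v, form M u v = form M' u v.
Proof.
move=> eqM u v; apply: eq_bigr => i _; congr (_ * _); apply: eq_bigr => j _.
by rewrite eqM.
Qed.

Lemma form0 M u v : (forall i j, M i j = 0) -> form M u v = 0.
Proof.
move=> M0; rewrite /form big1 // => i _; rewrite /mulmv big1 ?mulr0 // => j _.
by rewrite M0 mul0r.
Qed.

(* If the restriction of [M] to the span of [u] and [v] were positive definite,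
   that plane would meet the [M]-orthogonal of [w] in a positive vector. *)
Lemma hyperbolic_of_ref M w : (forall i j, M i j = M j i) ->
  0 < form M w w ->
  (forall v, form M w w * form M v v <= form M w v ^+ 2) -> hyperbolic M.
Proof.
move=> symM ww_gt0 hw u v uu_ge0.
set a := form M w u; set b := form M w v.
have := hw (comb b u (- a) v); rewrite (form_combr M w) -/a -/b form_comb2 //.
have -> : b * a + - a * b = 0 by ring.
rewrite expr0n /= pmulr_rle0 // => hz.
have := hw u; rewrite -/a => hu; rewrite leNgt; apply/negP => hlt.
set uu := form M u u in uu_ge0 hz hu hlt *.
set vv := form M v v in hz hlt *; set uv := form M u v in hz hlt *.
have uu_gt0 : 0 < uu.
  rewrite lt0r uu_ge0 andbT; apply/eqP => uu0.
  by move: hlt; rewrite uu0 mul0r ltNge sqr_ge0.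
have a2_gt0 : 0 < a ^+ 2 by apply: lt_le_trans hu; apply: mulr_gt0.
have := mulr_ge0 (ltW uu_gt0) (_ : 0 <= - (b ^+ 2 * uu + 2 * (b * - a) * uv + (- a) ^+ 2 * vv)).
rewrite oppr_ge0 => /(_ hz).
have := sqr_ge0 (b * uu - a * uv).
have : 0 < a ^+ 2 * (uu * vv - uv ^+ 2) by rewrite mulr_gt0 // subr_gt0.
by nra.
Qed.

End Forms.

(** * Bochner's method: from hyperbolic slices of a symmetric tensor to their sum *)

Section LocalToGlobal.
Context {R : realType} {I : finType}.
Variables (T : I -> I -> I -> R) (y : I).
Hypothesis T_ge0 : forall k i j, 0 <= T k i j.
Hypothesis TC : forall k i j, T k i j = T k j i.
Hypothesis TCl : forall k i j, T k i j = T i k j.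
Hypothesis hypT : forall k, hyperbolic (T k).

Let M i j := \sum_k T k i j.
Let d i := \sum_j M i j.
Let one : I -> R := fun=> 1.
Let dot (u v : I -> R) := \sum_i d i * u i * v i.
(** The Markov operator of the random walk with weights [M], self-adjoint for [dot]. Where [d i = 0]
    the whole row of [M] vanishes and the quotient is 0. *)
Let N (v : I -> R) : I -> R := fun i => mulmv M v i / d i.

Hypothesis conn : forall i, 0 < d i -> 0 < M i y.

Let MC i j : M i j = M j i.
Proof. by apply: eq_bigr => k _; rewrite TC. Qed.

Let M_ge0 i j : 0 <= M i j.
Proof. exact: sumr_ge0. Qed.

Let d_ge0 i : 0 <= d i.
Proof. exact: sumr_ge0. Qed.

Let d0 i : d i = 0 -> forall j, M i j = 0.
Proof. by move=> /eqP; rewrite psumr_eq0 // => /allP h j; apply/eqP/h/mem_index_enum. Qed.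

Let M0 i j : M i j = 0 -> forall k, T i j k = 0.
Proof.
move=> /eqP; rewrite psumr_eq0 // => /allP h k; rewrite TC TCl.
exact/eqP/h/mem_index_enum.
Qed.

Let dN v i : d i * N v i = mulmv M v i.
Proof.
rewrite /N; have [d_eq0|d_neq0] := eqVneq (d i) 0; last by rewrite mulrC divfK.
by rewrite d_eq0 mul0r /mulmv big1 // => j _; rewrite d0 ?mul0r.
Qed.

Let dotN u v : dot u (N v) = form M u v.
Proof. by apply: eq_bigr => i _; rewrite -dN; ring. Qed.

Let dotC u v : dot u v = dot v u.
Proof. by apply: eq_bigr => i _; ring. Qed.

Let dot_comb2 a u b v : dot (comb a u b v) (comb a u b v) =
  a ^+ 2 * dot u u + 2 * (a * b) * dot u v + b ^+ 2 * dot v v.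
Proof.
rewrite /dot !mulr_sumr -!big_split /=; apply: eq_bigr => i _; rewrite /comb; ring.
Qed.

Let dot_ge0 v : 0 <= dot v v.
Proof.
by apply: sumr_ge0 => i _; rewrite -mulrA mulr_ge0 // -expr2 sqr_ge0.
Qed.

Let form1 v : form M one v = \sum_i d i * v i.
Proof.
rewrite formC //; apply: eq_bigr => i _; rewrite mulrC; congr (_ * _).
by apply: eq_bigr => j _; rewrite mulr1.
Qed.

Let form1_dot v : form M one v = dot one v.
Proof. by rewrite form1; apply: eq_bigr => i _; rewrite mulr1. Qed.

(** The sign [s = 1] yields [N >= -1]; the sign [s = -1] yields the Dirichlet form of [1 - N]. *)
Let form_sqr v (s : R) : s ^+ 2 = 1 ->
  2 * (dot v v + s * form M v v) = \sum_i \sum_j M i j * (v i + s * v j) ^+ 2.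
Proof.
move=> s2.
have e1 : dot v v = \sum_i \sum_j M i j * v i ^+ 2.
  by apply: eq_bigr => i _; rewrite -mulrA -expr2 mulr_suml.
have e2 : dot v v = \sum_i \sum_j M i j * v j ^+ 2.
  rewrite e1 exchange_big /=; apply: eq_bigr => i _; apply: eq_bigr => j _.
  by rewrite MC.
have -> : 2 * (dot v v + s * form M v v) =
  dot v v + dot v v + 2 * s * form M v v by ring.
rewrite {1}e1 e2 /form !mulr_sumr -!big_split /=; apply: eq_bigr => i _.
rewrite /mulmv !mulr_sumr -!big_split /=; apply: eq_bigr => j _.
rewrite sqrrD exprMn s2; ring.
Qed.

Let form_lower v : 0 <= dot v v + form M v v.
Proof.
rewrite -(pmulr_rge0 _ (ltr0Sn R 1)) -[form M v v]mul1r form_sqr ?expr1n //.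
by apply: sumr_ge0 => i _; apply: sumr_ge0 => j _; rewrite mulr_ge0 ?sqr_ge0.
Qed.

(** Hyperbolicity of [T k] at [one] and [v] reads [d k * form (T k) v v <= (d k * N v k) ^+ 2];
    divide by [d k] and sum over [k]. *)
Let bochner v : form M v v <= dot (N v) (N v).
Proof.
have -> : form M v v = \sum_k form (T k) v v.
  rewrite /form exchange_big /=; apply: eq_bigr => i _; rewrite -mulr_sumr.
  congr (_ * _); rewrite /mulmv exchange_big /=; apply: eq_bigr => j _.
  by rewrite -mulr_suml.
apply: ler_sum => k _; rewrite dN.
have e1 u : form (T k) one u = mulmv M u k.
  rewrite formC // /form /mulmv; apply: eq_bigr => i _; rewrite mulrC.
  congr (_ * _); apply: eq_bigr => j _.
  by rewrite /one mulr1 TC TCl.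
have e11 : form (T k) one one = d k.
  by rewrite e1; apply: eq_bigr => j _; rewrite mulr1.
have := hypT k one v; rewrite e11 e1 => /(_ (d_ge0 k)).
have [dk0 _|dk_neq0 h] := eqVneq (d k) 0.
  rewrite form0; first by rewrite /N dk0 invr0 mulr0 mulr0.
  by move=> i j; rewrite M0 // d0.
have dk_gt0 : 0 < d k by rewrite lt0r dk_neq0 d_ge0.
by rewrite /N mulrA -expr2 ler_pdivlMr // mulrC.
Qed.

Let gap : exists2 e : R, 0 < e & forall i, e * d i <= M i y.
Proof.
suff [e e0 he] : exists2 e : R, 0 < e & forall i, i \in enum I -> e * d i <= M i y.
  by exists e => // i; apply: he; rewrite mem_enum.
elim: (enum I) => [|x s [e e0 he]]; first by exists 1.
have [dx0|dx_neq0] := eqVneq (d x) 0.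
  exists e => // i; rewrite inE => /orP[/eqP ->|]; last exact: he.
  by rewrite dx0 mulr0.
have dx_gt0 : 0 < d x by rewrite lt0r dx_neq0 d_ge0.
exists (Num.min e (M x y / d x)).
  by rewrite lt_min e0 divr_gt0 ?conn.
move=> i; rewrite inE => /orP[/eqP ->|/he hi].
  by rewrite -ler_pdivlMr // ge_min lexx orbT.
by apply: le_trans hi; rewrite ler_wpM2r // ge_min lexx.
Qed.

(** Each non-isolated index is joined to [y] by a fixed proportion [e] of its weight, so the edges
    at [y] alone bound the Dirichlet form below by [e * dot v v]. *)
Let poincare : exists2 s : R, 0 < s &
  forall v, dot one v = 0 -> (1 + s) * form M v v <= s * dot v v.
Proof.
(* The gap gives [form M v v <= (1 - e) * dot v v], and [1 - e <= s / (1 + s)] for this [s]. *)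
have [e e0 he] := gap; exists (1 + e^-1); first by rewrite addr_gt0 ?invr_gt0.
move=> v v0.
have h1 : e * (dot v v + v y ^+ 2 * \sum_i d i) <= \sum_i M i y * (v i - v y) ^+ 2.
  have -> : dot v v + v y ^+ 2 * \sum_i d i = \sum_i d i * (v i - v y) ^+ 2.
    have -> : dot v v + v y ^+ 2 * \sum_i d i =
      dot v v + v y ^+ 2 * \sum_i d i - 2 * v y * dot one v.
      by rewrite v0 mulr0 subr0.
    rewrite /dot !mulr_sumr -big_split -sumrB /=; apply: eq_bigr => i _.
    rewrite /one; ring.
  by rewrite mulr_sumr; apply: ler_sum => i _; rewrite mulrA ler_wpM2r ?sqr_ge0.
have h2 : \sum_i M i y * (v i - v y) ^+ 2 <= dot v v - form M v v.
  have e2 : (-1) ^+ 2 = 1 :> R by rewrite sqrrN expr1n.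
  have := form_sqr v (-1) e2; rewrite !mulN1r => h.
  rewrite -(ler_pM2l (ltr0Sn R 1)) h.
  have F_ge0 i j : 0 <= M i j * (v i + -1 * v j) ^+ 2 by rewrite mulr_ge0 ?sqr_ge0.
  (* Row [y] and column [y] of the double sum each supply one of the two copies of the left side. *)
  rewrite mulr2n mulrDl mul1r [leRHS](bigD1 y) //= lerD //.
    by apply: ler_sum => j _; rewrite MC mulN1r -sqrrN opprB.
  rewrite (bigD1 y) //= subrr expr0n mulr0 add0r.
  apply: ler_sum => i _; rewrite (bigD1 y) //= mulN1r ler_wpDr //.
  exact: sumr_ge0.
have h3 : e * dot v v <= dot v v - form M v v.
  apply: le_trans (le_trans h1 h2); rewrite ler_wpM2l ?(ltW e0) //.
  by rewrite lerDl mulr_ge0 ?sqr_ge0 ?sumr_ge0.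
rewrite -subr_ge0.
have -> : (1 + e^-1) * dot v v - (1 + (1 + e^-1)) * form M v v =
  e^-1 * (dot v v - form M v v - e * dot v v) + 2 * (dot v v - form M v v).
  by rewrite mulrBr mulrA mulVf ?gt_eqF //; ring.
have h4 : 0 <= dot v v - form M v v by apply: le_trans h3; rewrite mulr_ge0 ?(ltW e0).
by rewrite addr_ge0 // mulr_ge0 // ?invr_ge0 ?(ltW e0) ?subr_ge0.
Qed.

(* With [l := s / (1 + s)] the hypothesis reads [N <= l] on the orthogonal of
   [one]; then [(l - N)^2 (N + 1) + (l - N) (N + 1)^2 >= 0] there, and this sum
   is [(1 + l) (l - N) (N + 1)]. Together with [N <= N^2] it improves [l] to
   [l / (2 - l)], that is [s] to [s / 2]. *)
Let improve (s : R) : 0 < s ->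
  (forall v, dot one v = 0 -> (1 + s) * form M v v <= s * dot v v) ->
  (forall v, dot one v = 0 -> (2 + s) * form M v v <= s * dot v v).
Proof.
move=> s_gt0 hs v v0.
(* This vector is [(1 + s) (l - N) v]; the one in [r0] is [(N + 1) v], again orthogonal to [one]. *)
have p := form_lower (comb s v (- (1 + s)) (N v)).
have r0 : dot one (comb 1 (N v) 1 v) = 0.
  by rewrite -form1_dot form_combr !form1_dot dotN form1_dot v0; ring.
have := hs _ r0; have b := bochner v.
rewrite !form_comb2 // !dot_comb2 in p *.
have e1 : dot v (N v) = form M v v by rewrite dotN.
have e2 : form M v (N v) = dot (N v) (N v).
  by rewrite formC // -dotN.
have e3 : form M (N v) v = dot (N v) (N v) by rewrite formC.
rewrite e1 e2 in p; rewrite e3 (dotC (N v) v) e1.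
set m0 := dot v v in p *; set m1 := form M v v in p b *.
set m2 := dot (N v) (N v) in p b *; set m3 := form M (N v) (N v) in p *.
move=> q; rewrite -subr_ge0.
have c : 0 < (1 + s) * (1 + 2 * s) by apply: mulr_gt0; lra.
rewrite -(pmulr_rge0 _ c).
(* This is [p] plus [1 + s] times [q], up to a positive factor: the cubic terms [m3] cancel. *)
have : 0 <= (1 + s) * (1 + 2 * s) * (s * m0 - m1 - (1 + s) * m2) by nra.
have : 0 <= (1 + s) * (1 + 2 * s) * ((1 + s) * (m2 - m1)).
  by rewrite !mulr_ge0 //; lra.
by nra.
Qed.

(** Iterating [improve] from the constant of [poincare] sends [s] to 0. *)
Let form_orth_le0 v : dot one v = 0 -> form M v v <= 0.
Proof.
have [s s_gt0 hs] := poincare.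
have iter n : forall v, dot one v = 0 ->
    (1 + s / 2 ^+ n) * form M v v <= s / 2 ^+ n * dot v v.
  elim: n => [|n IH] u u0; first by rewrite expr0 divr1; apply: hs.
  have s'_gt0 : 0 < s / 2 ^+ n by rewrite divr_gt0 ?exprn_gt0.
  have := improve _ s'_gt0 IH u u0.
  have -> : s / 2 ^+ n.+1 = (s / 2 ^+ n) / 2 by rewrite exprSr invfM mulrA.
  set x := s / 2 ^+ n; lra.
move=> v0; rewrite leNgt; apply/negP => m_gt0.
(* Enough halvings to make [s / 2 ^+ n.+1 * dot v v] smaller than [form M v v]. *)
pose n := Num.truncn (s * dot v v / form M v v).
have := iter n.+1 v v0.
have hn : s * dot v v < 2 ^+ n.+1 * form M v v.
  rewrite -ltr_pdivrMr //.
  apply: lt_le_trans (truncnS_gt _) _.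
  by rewrite -natrX ler_nat ltnW // ltn_expl.
have p2 : 0 < 2 ^+ n.+1 :> R by rewrite exprn_gt0.
have : s / 2 ^+ n.+1 * dot v v < form M v v.
  by rewrite mulrAC ltr_pdivrMr // [ltRHS]mulrC.
have : 0 < s / 2 ^+ n.+1 * form M v v by rewrite mulr_gt0 ?divr_gt0.
lra.
Qed.

(* Bochner's method: the Cauchy-Schwarz inequalities of the [T k], taken against
   the all-ones vector, say that the Markov operator [N] satisfies [N <= N^2];
   as [N < 1] on the orthogonal of the constants, [N <= 0] there. *)
Lemma hyperbolic_contraction : hyperbolic (fun i j => \sum_k T k i j).
Proof.
have dW : form M one one = \sum_i d i.
  by rewrite form1; apply: eq_bigr => i _; rewrite mulr1.
have [W0|W_neq0] := eqVneq (form M one one) 0.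
  have MM0 i j : M i j = 0.
    move: W0; rewrite dW => /eqP; rewrite psumr_eq0 // => /allP h.
    by apply: d0; apply/eqP/h/mem_index_enum.
  by move=> u v _; rewrite !form0 // mul0r expr0n.
have W_gt0 : 0 < form M one one by rewrite lt0r W_neq0 dW sumr_ge0.
apply: (hyperbolic_of_ref _ one) => // v.
(* A multiple of the projection of [v] onto the orthogonal of [one]. *)
have := form_orth_le0 (comb (form M one one) v (- form M one v) one).
rewrite -form1_dot form_combr form_comb2 // (formC _ v) // => h.
have {}h := h ltac:(ring).
rewrite -subr_le0 -(pmulr_rle0 _ W_gt0); apply: le_trans h.
rewrite le_eqVlt; apply/orP; left; apply/eqP; ring.
Qed.

End LocalToGlobal.

(** * Ultrametric matrices *)

Section Ultrametric.
Context {R : realType} {I : finType}.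

Lemma sqr_sum_pair (a v : I -> R) :
  \sum_i \sum_j a i * a j * v i * v j = (\sum_i a i * v i) ^+ 2.
Proof.
rewrite expr2 mulr_suml; apply: eq_bigr => i _; rewrite mulr_sumr.
by apply: eq_bigr => j _; ring.
Qed.

(* Writing [e i j] as [\sum_k e k i * e k j / n k], with [n k] the size of the
   class of [k], exhibits the form as a sum of squares. *)
Lemma per_form_ge0 (e : rel I) (v : I -> R) : symmetric e -> transitive e ->
  0 <= \sum_i \sum_j (e i j)%:R * v i * v j.
Proof.
move=> symE trE; pose n k : R := (#|[pred i | e k i]|)%:R.
have -> : \sum_i \sum_j (e i j)%:R * v i * v j =
    \sum_k (n k)^-1 * (\sum_i (e k i)%:R * v i) ^+ 2.
  under [RHS]eq_bigr do rewrite -sqr_sum_pair mulr_sumr.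
  rewrite [RHS]exchange_big /=; apply: eq_bigr => i _.
  under [RHS]eq_bigr do rewrite mulr_sumr.
  rewrite [RHS]exchange_big /=; apply: eq_bigr => j _.
  under [RHS]eq_bigr do rewrite !mulrA.
  rewrite -!mulr_suml. congr (_ * _ * _); apply: esym.
  have [eij|neij] := boolP (e i j); last first.
    rewrite big1 // => k _; have [eki|] := boolP (e k i); last by rewrite mulr0 mul0r.
    have [ekj|] := boolP (e k j); last by rewrite mulr0.
    by case/negP: neij; apply: trE ekj; rewrite symE.
  have eii : e i i by apply: (trE j) => //; rewrite symE.
  rewrite (eq_bigr (fun k => if e i k then (n i)^-1 else 0)) => [|k _]; last first.
    rewrite (symE k i); have [eik|] := boolP (e i k); last by rewrite mulr0 mul0r.
    have -> : e k j by apply: trE eij; rewrite symE.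
    rewrite !mulr1 /n; congr (_%:R^-1); apply: eq_card => l; rewrite !inE.
    apply/idP/idP; first by apply: trE.
    by apply: trE; rewrite symE.
  have n_neq0 : n i != 0.
    by rewrite pnatr_eq0 -lt0n; apply/card_gt0P; exists i; exact: eii.
  rewrite -big_mkcond sumr_const -[LHS]mulr_natl; exact: mulfV.
apply: sumr_ge0 => k _; rewrite mulr_ge0 ?sqr_ge0 ?invr_ge0 //.
Qed.

(* Subtracting the least positive value from all positive values peels off a
   partial equivalence relation and keeps the ultrametric inequality. *)
Lemma ultrametric_form_ge0 (c : I -> I -> R) (v : I -> R) :
  (forall i j, 0 <= c i j) -> (forall i j, c i j = c j i) ->
  (forall i j k, Num.min (c i k) (c k j) <= c i j) ->
  0 <= \sum_i \sum_j c i j * v i * v j.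
Proof.
pose supp (c : I -> I -> R) := [pred p : I * I | 0 < c p.1 p.2].
(* Induction on the number of positive entries; each peeling cancels at least the minimal one. *)
have [m] := ubnP #|supp c|; elim: m c => // m IH c ltm c0 cC cU.
have [[i0 j0] /= p0|none] := pickP (supp c); last first.
  apply: sumr_ge0 => i _; apply: sumr_ge0 => j _.
  have /= := none (i, j); rewrite lt0r c0 andbT => /negbFE/eqP ->.
  by rewrite !mul0r.
case: (@Order.TotalTheory.arg_minP _ _ _ (i0, j0) (supp c) (fun p => c p.1 p.2) p0).
move=> [i1 j1] /= mu_gt0 mu_min; set mu := c i1 j1 in mu_gt0 mu_min.
have {}mu_min i j : 0 < c i j -> mu <= c i j by move/(mu_min (i, j)).
pose e i j := 0 < c i j; pose c' i j := c i j - mu *+ e i j.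
have eP i j : (e i j /\ mu <= c i j) \/ (~~ e i j /\ c i j = 0).
  rewrite /e; have [p|] := ltP 0 (c i j); first by left; rewrite mu_min.
  by rewrite le_eqVlt ltNge c0 orbF => /eqP; right.
have -> : \sum_i \sum_j c i j * v i * v j =
    \sum_i \sum_j c' i j * v i * v j + mu * \sum_i \sum_j (e i j)%:R * v i * v j.
  rewrite mulr_sumr -big_split; apply: eq_bigr => i _ /=.
  rewrite mulr_sumr -big_split; apply: eq_bigr => j _ /=.
  by rewrite /c' -mulr_natr; ring.
apply: addr_ge0; last first.
  rewrite mulr_ge0 ?(ltW mu_gt0) // per_form_ge0 //; first by move=> i j; rewrite /e cC.
  by move=> k i j eik ekj; apply: lt_le_trans (cU i j k); rewrite lt_min; apply/andP.
apply: IH.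
- apply: leq_trans (_ : #|supp c| <= m)%N => //; apply: proper_card.
  apply/properP; split.
    apply/subsetP => -[i j]; rewrite !inE /c' /=.
    by case: (eP i j) => -[]; rewrite /e // => _ ->; rewrite sub0r oppr_gt0 ltNge mulrn_wge0 ?ltW.
  by exists (i1, j1); rewrite !inE //= /c' /e -/mu mu_gt0 subrr ltxx.
- move=> i j; rewrite /c'.
  by case: (eP i j) => -[] => [-> ?|/negbTE -> ->]; rewrite ?subr_ge0 ?subr0.
- by move=> i j; rewrite /c' /e cC.
move=> i j k; rewrite ge_min /c'.
have := cU i j k; rewrite ge_min.
by case: (eP i k) => -[]; case: (eP k j) => -[]; case: (eP i j) => -[];
  do 3![move=> /negbTE -> -> | move=> -> ?]; rewrite ?mulr1n ?mulr0n => /orP[] ?;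
  apply/orP; (left; lra) || (right; lra).
Qed.

End Ultrametric.

(** * Hessians of the homogenized generating polynomial *)

Section Independence.
Context {R : realType} {E : finType}.
Implicit Types (S X Y : {set E}) (i j k : option E).

(* [None] stands for the homogenizing variable. *)
Definition ins S i : {set E} := if i is Some x then x |: S else S.
Definition fresh S i : bool := if i is Some x then x \notin S else true.

Lemma insC S i j : ins (ins S i) j = ins (ins S j) i.
Proof. by case: i => [x|]; case: j => [y|] //=; rewrite setUCA. Qed.

Lemma freshC S i j :
  fresh S i && fresh (ins S i) j = fresh S j && fresh (ins S j) i.
Proof.
case: i => [x|]; case: j => [y|] //=; rewrite ?andbT // !inE !negb_or eq_sym.
by case: (x != y); case: (x \notin S); case: (y \notin S).
Qed.

(** Multiplicative form of the local exchange properties of [ext_nu]: the pair inequality makes the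
    Schur complement entrywise nonnegative, the triple one makes it ultrametric. *)
Record matroidal (f : {set E} -> R) : Prop := {
  matroidal_ge0 : forall S, 0 <= f S;
  matroidal_eq0 : forall S x, f S = 0 -> f (x |: S) = 0;
  matroidal_pair : forall S x y, x \notin S -> y \notin S -> x != y ->
    f S * f (y |: (x |: S)) <= f (x |: S) * f (y |: S);
  matroidal_triple : forall S x y z,
    x \notin S -> y \notin S -> z \notin S -> x != y -> x != z -> y != z ->
    f (y |: (x |: S)) * f (z |: S) <=
      Num.max (f (z |: (x |: S)) * f (y |: S)) (f (z |: (y |: S)) * f (x |: S))
}.

Section Hessian.
Variable f : {set E} -> R.

(* [f] stands for the polynomial of all [f S * x^S], each monomial completed
   with a power of the homogenizing variable, normalized as in [y^a / a`!];
   [seqsum n S] is [n`!] times the value at the all-ones vector of its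
   derivative along [S], taken in degree [#|S| + n]. *)
Fixpoint seqsum n S : R :=
  if n is n'.+1 then \sum_(k | fresh S k) seqsum n' (ins S k) else f S.

Definition hessian n S i j : R :=
  if fresh S i && fresh (ins S i) j then seqsum n (ins (ins S i) j) else 0.

Hypothesis mf : matroidal f.

Lemma seqsum_ge0 n S : 0 <= seqsum n S.
Proof.
elim: n S => [|n IH] S /=; first exact: matroidal_ge0.
exact: sumr_ge0.
Qed.

Lemma seqsum_le n S : seqsum n S <= seqsum n.+1 S.
Proof.
rewrite [leRHS]/= (bigD1 None) //= lerDl sumr_ge0 // => k _.
exact: seqsum_ge0.
Qed.

Lemma seqsum_eq0 n S : f S = 0 -> seqsum n S = 0.
Proof.
elim: n S => [|n IH] S f0 //=; rewrite big1 // => k _; apply: IH.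
by case: k => [x|] //=; apply: matroidal_eq0.
Qed.

(** Since [0 <= f S <= seqsum n S], vanishing passes to [f S] and from there to all larger sets. *)
Lemma seqsum_ins_eq0 n S i : seqsum n S = 0 -> seqsum n (ins S i) = 0.
Proof.
case: i => [x|//] H0; apply/seqsum_eq0/matroidal_eq0 => //.
apply/eqP; rewrite eq_le matroidal_ge0 // andbT -{}H0.
by elim: n => [|n IH] //; apply: le_trans IH (seqsum_le _ _).
Qed.

Lemma hessianC n S i j : hessian n S i j = hessian n S j i.
Proof. by rewrite /hessian freshC insC. Qed.

(** With the basis vector at [None] as reference, the claim is that [a i * a j - f S * M i j] is
    positive semidefinite. Rescaling coordinates by [a] turns it into [c], with values in [0, 1] and
    diagonal entry 1 at every non-loop. *)
Lemma hessian0_hyperbolic S : hyperbolic (hessian 0 S).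
Proof.
have f_ge0 := matroidal_ge0 f mf.
have [fS0|fS_neq0] := eqVneq (f S) 0.
  have h0 i j : hessian 0 S i j = 0.
    by rewrite /hessian; case: ifP => // _; rewrite 2?(seqsum_ins_eq0 0).
  by move=> u v _; rewrite !form0 // mul0r expr0n.
have fS_gt0 : 0 < f S by rewrite lt0r fS_neq0 f_ge0.
pose M := hessian 0 S; pose a i := M None i.
have aE i : a i = if fresh S i then f (ins S i) else 0 by [].
have MNN : M None None = f S by [].
have MC i j : M i j = M j i by apply: hessianC.
have M_ge0 i j : 0 <= M i j by rewrite /M /hessian; case: ifP.
have M0 i j : a i = 0 -> M i j = 0.
  rewrite aE /M /hessian; case: (fresh S i) => //=; case: ifP => // _ f0.
  exact: (@seqsum_ins_eq0 0).
have MSub i j : f S * M i j <= a i * a j.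
  rewrite !aE /M /hessian; case: i => [x|]; last by case: ifP.
  case: j => [y|] /=; last by rewrite andbT mulrC.
  rewrite !inE negb_or; have [xS|] /= := boolP (x \notin S); last by rewrite mulr0 mul0r.
  have [yS|] /= := boolP (y \notin S); last by rewrite andbF !mulr0.
  rewrite andbT; have [->|yx] := eqVneq y x; first by rewrite mulr0 mulr_ge0.
  by rewrite matroidal_pair // eq_sym.
pose ref k : R := (k == None)%:R.
have refM v : form M ref v = \sum_i a i * v i.
  rewrite /form (bigD1 None) //= big1 ?addr0 => [|i /negbTE iN].
    by rewrite /ref eqxx mul1r.
  by rewrite /ref iN mul0r.
have ref2 : form M ref ref = f S.
  rewrite refM (bigD1 None) //= big1 ?addr0 => [|i /negbTE iN].
    by rewrite /ref eqxx mulr1.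
  by rewrite /ref iN mulr0.
apply: (hyperbolic_of_ref M ref) => //; first by rewrite ref2.
move=> v; rewrite ref2 refM -subr_ge0.
pose c i j := if (a i == 0) || (a j == 0) then 0 else 1 - f S * M i j / (a i * a j).
have -> : (\sum_i a i * v i) ^+ 2 - f S * form M v v =
    \sum_i \sum_j c i j * (a i * v i) * (a j * v j).
  rewrite -sqr_sum_pair /form mulr_sumr -sumrB; apply: eq_bigr => i _.
  rewrite /mulmv !mulr_sumr -sumrB; apply: eq_bigr => j _; rewrite /c.
  have [ai0|ai_neq0] /= := eqVneq (a i) 0; first by rewrite M0 // ai0; ring.
  have [aj0|aj_neq0] /= := eqVneq (a j) 0; first by rewrite MC M0 // aj0; ring.
  by field; apply/andP.
have a_gt0 i : a i != 0 -> 0 < a i by move=> h; rewrite lt0r h /a M_ge0.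
have c_ge0 i j : 0 <= c i j.
  rewrite /c; case: ifP => // /norP[/a_gt0 ai /a_gt0 aj].
  by rewrite subr_ge0 ler_pdivrMr ?mulr_gt0 // mul1r.
have c_le1 i j : c i j <= 1.
  rewrite /c; case: ifP => // _; rewrite gerBl.
  by apply: divr_ge0; apply: mulr_ge0 => //; apply: M_ge0.
have cC i j : c i j = c j i by rewrite /c orbC MC [a i * _]mulrC.
have c_diag i : M i i = 0 -> a i != 0 -> c i i = 1.
  by move=> Mii ai; rewrite /c (negbTE ai) /= Mii mulr0 mul0r subr0.
have cN i : c None i = 0.
  rewrite /c; case: ifP => // /norP[ha hi].
  by rewrite -/(a i) /a MNN divff ?subrr // mulf_neq0.
have cS x : a (Some x) != 0 -> c (Some x) (Some x) = 1.
  by apply: c_diag; rewrite /M /hessian /= !inE eqxx /= andbF.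
apply: ultrametric_form_ge0 => // i j k; rewrite ge_min.
case: k => [z|]; last by rewrite (cC i) cN c_ge0.
case: i => [x|]; last by rewrite !cN lexx.
case: j => [y|]; last by rewrite orbC !(cC _ None) !cN lexx.
have [ax0|ax] := eqVneq (a (Some x)) 0; first by rewrite /c ax0 eqxx /= lexx.
have [ay0|ay] := eqVneq (a (Some y)) 0; first by rewrite orbC /c ay0 eqxx !orbT /= lexx.
have [az0|az] := eqVneq (a (Some z)) 0; first by rewrite {1}/c az0 eqxx orbT /= c_ge0.
have [<-|xy] := eqVneq x y; first by rewrite cS // c_le1.
have [<-|xz] := eqVneq x z; first by rewrite lexx orbT.
have [<-|yz] := eqVneq y z; first by rewrite lexx.
have frA w : a (Some w) != 0 -> w \notin S.
  by rewrite aE /=; case: ifP => //; rewrite eqxx.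
have [xS [yS zS]] := (frA _ ax, (frA _ ay, frA _ az)).
have aS w : w \notin S -> a (Some w) = f (w |: S) by rewrite aE /= => ->.
have MS w w' : w \notin S -> w' \notin S -> w != w' ->
    M (Some w) (Some w') = f (w' |: (w |: S)).
  by move=> h h' ww'; rewrite /M /hessian /= !inE negb_or h h' eq_sym ww'.
(* Multiplied by [f S] and divided by the three values of [a], this is the ultrametric inequality
   for [c]. *)
have := matroidal_triple f mf S x y z xS yS zS xy xz yz.
rewrite -!aS // -!MS // le_max.
rewrite /c !(negbTE ax, negbTE ay, negbTE az) /= (MC (Some z) (Some y)).
move: (a_gt0 _ ax) (a_gt0 _ ay) (a_gt0 _ az).
move: (a _) (a _) (a _) (M _ _) (M _ _) (M _ _) => ax' ay' az' mxy mxz myz.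
clear -fS_gt0 => hx hy hz; rewrite !lerD2l !lerN2.
have fac p p' a1 a2 a3 : 0 < a1 -> 0 < a2 -> 0 < a3 -> p * a3 <= p' * a2 ->
    f S * p / (a1 * a2) <= f S * p' / (a1 * a3).
  move=> h1 h2 h3 h; rewrite -subr_ge0.
  have -> : f S * p' / (a1 * a3) - f S * p / (a1 * a2) =
      f S / (a1 * a2 * a3) * (p' * a2 - p * a3).
    by field; rewrite !gt_eqF.
  by rewrite mulr_ge0 ?subr_ge0 // divr_ge0 ?(ltW fS_gt0) // !mulr_ge0 // ltW.
case/orP => h; apply/orP; [left|right]; first exact: fac.
by rewrite [ax' * _]mulrC [az' * _]mulrC; apply: fac.
Qed.

(** The third derivatives form a symmetric tensor whose slice at [k] is the Hessian of [ins S k] one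
    degree lower; [None] serves as the connecting index. *)
Lemma hessian_hyperbolic n S : hyperbolic (hessian n S).
Proof.
elim: n S => [|n IH] S; first exact: hessian0_hyperbolic.
pose T k i j := if fresh S k then hessian n (ins S k) i j else 0.
have TE k i j : T k i j =
    if fresh S k && fresh (ins S k) i && fresh (ins (ins S k) i) j
    then seqsum n (ins (ins (ins S k) i) j) else 0.
  by rewrite /T /hessian -andbA; case: (fresh S k).
have TC k i j : T k i j = T k j i by rewrite /T hessianC.
have TCl k i j : T k i j = T i k j by rewrite !TE freshC insC.
have MT i j : \sum_k T k i j = hessian n.+1 S i j.
  under eq_bigr do rewrite TCl TC TE.
  rewrite /hessian; have [fij|nfij] := boolP (_ && _); last first.
    by rewrite big1.
  rewrite [RHS]/= [RHS]big_mkcond; exact: eq_bigr.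
have T_ge0 k i j : 0 <= T k i j by rewrite TE; case: ifP => // _; apply: seqsum_ge0.
have hT k : hyperbolic (T k).
  rewrite /T; case: (fresh S k) => [|u v _]; first exact: IH.
  by rewrite !form0 // mul0r expr0n.
suff h : hyperbolic (fun i j => \sum_k T k i j).
  by move=> u v; rewrite -!(eq_form MT); apply: h.
apply: (hyperbolic_contraction T None) => // i.
rewrite lt0r sumr_ge0 ?andbT => [|j _]; last by rewrite sumr_ge0.
(* The entry at [None] is [seqsum n.+1 (ins S i)]; if it vanishes, so does the whole row. *)
apply: contra_neqT => h; apply: big1 => j _.
move: h; rewrite !MT -leNgt /hessian /= andbT => h.
have [fi|] /= := boolP (fresh S i) => //; case: ifP => // _.
apply: (@seqsum_ins_eq0 n.+1); apply/eqP; rewrite eq_le seqsum_ge0 andbT.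
by move: h; rewrite fi.
Qed.

Lemma seqsum_logconcave n :
  seqsum n set0 * (\sum_(i | i != None) \sum_(j | j != None) hessian n set0 i j)
    <= seqsum n.+1 set0 ^+ 2.
Proof.
pose u i : R := (i == None)%:R; pose v i : R := (i != None)%:R.
have fr i : fresh set0 i by case: i => [x|] //=; rewrite inE.
have uM w : form (hessian n set0) u w = \sum_j hessian n set0 None j * w j.
  rewrite /form (bigD1 None) //= big1 ?addr0 => [|i /negbTE iN].
    by rewrite /u eqxx mul1r.
  by rewrite /u iN mul0r.
have uu : form (hessian n set0) u u = seqsum n set0.
  rewrite uM (bigD1 None) //= big1 ?addr0 => [|i /negbTE iN].
    by rewrite /u eqxx mulr1.
  by rewrite /u iN mulr0.
have vv : form (hessian n set0) v v =
    \sum_(i | i != None) \sum_(j | j != None) hessian n set0 i j.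
  rewrite [RHS]big_mkcond; apply: eq_bigr => i _; rewrite /v.
  case: (i != None); last by rewrite mul0r.
  rewrite mul1r [RHS]big_mkcond; apply: eq_bigr => j _.
  by case: (j != None); rewrite ?mulr1 ?mulr0.
have := hessian_hyperbolic n set0 u v; rewrite uu vv => /(_ (seqsum_ge0 _ _)) h.
apply: le_trans h _; rewrite ler_sqr ?nnegrE ?seqsum_ge0 //; last first.
  rewrite uM sumr_ge0 // => j _; rewrite mulr_ge0 ?ler0n // /hessian.
  by case: ifP => // _; apply: seqsum_ge0.
(* The cross term is [seqsum n.+1 set0] without its nonnegative summand at [None]. *)
rewrite uM [leRHS](eq_bigl xpredT) //; apply: ler_sum => j _.
rewrite /hessian /= fr ler_piMr ?seqsum_ge0 // /v.
by case: (j != None); rewrite ?lexx ?ler01.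
Qed.

End Hessian.

(** * Eliminating the homogenizing variable by scaling *)

Section Scaling.
Variable f : {set E} -> R.
Hypothesis mf : matroidal f.

Definition scaled (t : R) S : R := t ^+ #|S| * f S.

Lemma matroidal_scaled t : 0 < t -> matroidal (scaled t).
Proof.
move=> t_gt0; have cU S x : x \notin S -> t ^+ #|x |: S| = t * t ^+ #|S|.
  by move=> xS; rewrite cardsU1 xS exprS.
have cU2 S x y : x \notin S -> y \notin S -> x != y ->
    t ^+ #|y |: (x |: S)| = t * (t * t ^+ #|S|).
  by move=> xS yS xy; rewrite !cU // !inE negb_or eq_sym xy.
split.
- by move=> S; rewrite mulr_ge0 ?exprn_ge0 ?(ltW t_gt0) ?matroidal_ge0.
- move=> S x /eqP; rewrite mulf_eq0 expf_eq0 (gt_eqF t_gt0) andbF => /eqP f0.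
  by rewrite /scaled matroidal_eq0 // mulr0.
- move=> S x y xS yS xy; rewrite /scaled cU2 // !cU //.
  set p := t ^+ _; rewrite [leLHS](_ : _ = (t * p) ^+ 2 * (f S * f (y |: (x |: S)))); last by ring.
  rewrite [leRHS](_ : _ = (t * p) ^+ 2 * (f (x |: S) * f (y |: S))); last by ring.
  by rewrite ler_wpM2l ?sqr_ge0 // matroidal_pair.
move=> S x y z xS yS zS xy xz yz; rewrite /scaled !cU2 // !cU //.
set p := t ^+ _; have q_ge0 : 0 <= t * (t * p) * (t * p).
  by rewrite !mulr_ge0 // ?exprn_ge0 // ltW.
have e a b : t * (t * p) * a * (t * p * b) = t * (t * p) * (t * p) * (a * b) by ring.
by rewrite !e -maxr_pMr // ler_wpM2l // matroidal_triple.
Qed.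

(** The analogue of [seqsum] with the homogenizing variable set to 0. *)
Fixpoint puresum n S : R :=
  if n is n'.+1 then \sum_(k | fresh S k && (k != None)) puresum n' (ins S k)
  else f S.

Lemma ins_card S k : fresh S k -> k != None -> #|ins S k| = #|S|.+1.
Proof. by case: k => [x|] //= xS _; rewrite cardsU1 xS. Qed.

(** Each [X] is reached once for every ordering of [X :\: S]. In the induction, [X] is counted once
    for each of its [n.+1] possible first elements. *)
Lemma puresumE n S :
  puresum n S = n`!%:R * \sum_(X : {set E} | (S \subset X) && (#|X| == #|S| + n)%N) f X.
Proof.
elim: n S => [|n IH] S /=.
  rewrite mul1r addn0 (bigD1 S) /= ?subxx ?eqxx // big1 ?addr0 // => X.
  case/andP => /andP[SX /eqP cX] /eqP []; apply/esym/eqP.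
  by rewrite eqEcard SX cX leqnn.
under eq_bigr do rewrite IH; rewrite -mulr_sumr factS natrM [RHS]mulrAC [RHS]mulrC.
congr (_ * _); rewrite mulr_sumr.
rewrite (exchange_big_dep (fun X : {set E} => (S \subset X) && (#|X| == #|S| + n.+1)%N)) /=.
  apply: eq_bigr => X /andP[SX /eqP cX].
  rewrite sumr_const mulr_natl; congr (_ *+ _).
  have -> : n.+1 = #|X :\: S| by rewrite cardsDS // cX addKn.
  rewrite -(card_imset (X :\: S) (@Some_inj _)); apply: eq_card => k.
  apply/andP/imsetP => [[/andP[fk kN] /andP[sk _]]|[x]].
    case: k fk kN sk => [x|] //= xS _; rewrite subUset sub1set => /andP[xX _].
    by exists x => //; rewrite inE xS.
  rewrite inE => /andP[xS xX] ->; split; first by rewrite /= xS.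
  by rewrite /= subUset sub1set xX SX cardsU1 xS cX add1n addSnnS /=.
move=> k X /andP[fk kN] /andP[sk /eqP cX]; rewrite cX ins_card // addSnnS eqxx andbT.
by apply: subset_trans sk; case: k {fk kN cX} => [x|] //=; apply: subsetUr.
Qed.

Lemma scaled_lower t n S : 0 < t ->
  t ^+ (#|S| + n) * puresum n S <= seqsum (scaled t) n S.
Proof.
move=> t_gt0; have ms := matroidal_scaled _ t_gt0.
elim: n S => [|n IH] S /=; first by rewrite addn0.
rewrite mulr_sumr big_mkcondr; apply: ler_sum => k fk.
case: ifP => [kN|_]; last exact: seqsum_ge0.
by apply: le_trans (IH _); rewrite ins_card // addSnnS.
Qed.

(** Each use of [None] in place of an element costs a factor [t], so only pure sequences reach the
    top power. *)
Lemma scaled_upper n S : exists2 C : R, 0 <= C & forall t, 1 <= t ->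
  seqsum (scaled t) n S <= t ^+ (#|S| + n) * (puresum n S + C / t).
Proof.
elim: n S => [|n IH] S /=.
  by exists 0 => // t _; rewrite mul0r addr0 addn0.
have [C0 C0_ge0 hC0] := IH S.
have [C C_ge0 hC] : exists2 C : R, 0 <= C & forall t, 1 <= t ->
    \sum_(k | fresh S k && (k != None)) seqsum (scaled t) n (ins S k) <=
    t ^+ (#|S| + n.+1) * (puresum n.+1 S + C / t).
  rewrite /=; elim: (index_enum _) => [|k s [C C_ge0 hC]].
    by exists 0 => // t _; rewrite !big_nil mul0r addr0 mulr0.
  have [|nk] := boolP (fresh S k && (k != None)); last first.
    by exists C => // t t1; rewrite !big_cons (negbTE nk) hC.
  move=> /[dup] fk /andP[fr kN]; have [C1 C1_ge0 hC1] := IH (ins S k).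
  exists (C1 + C) => [|t t1]; first exact: addr_ge0.
  rewrite !big_cons fk [leRHS](_ : _ = t ^+ (#|S| + n.+1) * (puresum n (ins S k) + C1 / t) +
    t ^+ (#|S| + n.+1) * (\sum_(j <- s | fresh S j && (j != None)) puresum n (ins S j) + C / t)).
    by rewrite lerD ?hC //; apply: le_trans (hC1 t t1) _; rewrite ins_card // addSnnS.
  by rewrite mulrDl; ring.
have pS_ge0 : 0 <= puresum n S.
  by rewrite puresumE mulr_ge0 // sumr_ge0 // => X _; apply: matroidal_ge0.
(* The summand at [None] is at most [t ^+ (#|S| + n) * (puresum n S + C0)], one power of [t] below
   the target. *)
exists (puresum n S + C0 + C) => [|t t1]; first by rewrite !addr_ge0.
have t_gt0 : 0 < t := lt_le_trans ltr01 t1.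
rewrite (bigD1 None) //= [leRHS](_ : _ =
  t ^+ (#|S| + n) * (puresum n S + C0) + t ^+ (#|S| + n.+1) * (puresum n.+1 S + C / t)).
  rewrite lerD ?hC //; apply: le_trans (hC0 t t1) _.
  rewrite ler_wpM2l ?exprn_ge0 ?(ltW t_gt0) // lerD2l ler_pdivrMr //.
  by rewrite ler_peMr.
by rewrite addnS exprS /=; field; rewrite gt_eqF.
Qed.

Lemma puresum_logconcave n : puresum n set0 * puresum n.+2 set0 <= puresum n.+1 set0 ^+ 2.
Proof.
have p_ge0 m S : 0 <= puresum m S.
  by rewrite puresumE mulr_ge0 // sumr_ge0 // => X _; apply: matroidal_ge0.
have [C C_ge0 hC] := scaled_upper n.+1 set0.
set a := puresum n.+1 set0 in hC *; set b := _ * _.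
have a_ge0 : 0 <= a by apply: p_ge0.
have bound t : 1 <= t -> b <= (a + C / t) ^+ 2.
  move=> t1; have t_gt0 : 0 < t := lt_le_trans ltr01 t1.
  have ms := matroidal_scaled _ t_gt0.
  have tn m : 0 < t ^+ m by rewrite exprn_gt0.
  have h1 := scaled_lower _ n set0 t_gt0.
  have h2 : t ^+ n.+2 * puresum n.+2 set0 <=
      \sum_(i | i != None) \sum_(j | j != None) hessian (scaled t) n set0 i j.
    rewrite [puresum n.+2 _]/= mulr_sumr big_andbC big_mkcondr; apply: ler_sum => i iN.
    rewrite /hessian; case: ifP => [fi|_]; last first.
      by rewrite sumr_ge0 // => j _; rewrite andFb.
    rewrite mulr_sumr [leLHS](eq_bigl (fun j => (j != None) && fresh (ins set0 i) j)); last first.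
      by move=> j; rewrite andbC.
    rewrite big_mkcondr; apply: ler_sum => j jN /=; case: ifP => // fj.
    by apply: le_trans (scaled_lower _ _ _ t_gt0); rewrite !ins_card // cards0.
  have h3 := seqsum_logconcave _ ms n; have := hC t t1.
  rewrite !cards0 !add0n in h1 *; move=> h4.
  have h5 : t ^+ n * puresum n set0 * (t ^+ n.+2 * puresum n.+2 set0) <=
      (t ^+ n.+1 * (a + C / t)) ^+ 2.
    have tp_ge0 m : 0 <= t ^+ m * puresum m set0 by rewrite mulr_ge0 // ltW // tn.
    apply: le_trans (ler_pM (tp_ge0 _) (tp_ge0 _) h1 h2) _.
    apply: le_trans h3 _; rewrite ler_sqr ?nnegrE ?seqsum_ge0 //.
    by rewrite mulr_ge0 ?(ltW (tn _)) // addr_ge0 // divr_ge0 // ltW.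
  rewrite -(ler_pM2l (exprn_gt0 2 (tn n.+1))) -exprMn; apply: le_trans h5.
  by rewrite le_eqVlt; apply/orP; left; apply/eqP; rewrite /b !exprS; ring.
rewrite leNgt; apply/negP => hlt; have {hlt} d_gt0 : 0 < b - a ^+ 2 by rewrite subr_gt0.
(* For [t >= 1] one has [(a + C / t) ^+ 2 <= a ^+ 2 + K / t]; the next [t] makes [K / t] smaller
   than [b - a ^+ 2]. *)
pose K := 2 * a * C + C ^+ 2; have K_ge0 : 0 <= K by rewrite addr_ge0 ?sqr_ge0 ?mulr_ge0.
pose t := 1 + K / (b - a ^+ 2).
have t1 : 1 <= t by rewrite lerDl divr_ge0 // ltW.
have t_gt0 : 0 < t := lt_le_trans ltr01 t1.
have := bound t t1; rewrite leNgt => /negP; apply.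
apply: (@le_lt_trans _ _ (a ^+ 2 + K / t)); last first.
  rewrite -ltrBrDl ltr_pdivrMr // /t mulrDr mulr1 mulrCA divff ?gt_eqF // mulr1.
  by rewrite ltrDr.
rewrite sqrrD -addrA lerD2l /K [leRHS](_ : _ = a * (C / t) *+ 2 + C ^+ 2 / t).
  by rewrite lerD2l exprMn expr2 mulrA ler_piMr ?divr_ge0 ?sqr_ge0 ?(ltW t_gt0) // ?invf_le1.
by rewrite -mulr_natr; ring.
Qed.

End Scaling.
End Independence.

(** * The extension of a valuated matroid *)

Section Valuated.
Context {R : realType} {E : finType}.
Variables (G : {pred R}) (r : nat) (nu : {set E} -> option R) (q : R).
Hypothesis vm : valuated_matroid G r nu.
Hypotheses (q_gt0 : 0 < q) (q_le1 : q <= 1).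

Let f S := qpow q (ext_nu r nu S).

Let qpow_ge0 x : 0 <= qpow q x.
Proof. by case: x => [a|] //=; apply: powR_ge0. Qed.

Let qpow_le x z : ole x z -> qpow q z <= qpow q x.
Proof.
case: x z => [a|] [b|] //= ab; last exact: powR_ge0.
by apply: ger_powR => //; rewrite q_gt0.
Qed.

Let qpowD x z : qpow q (oadd x z) = qpow q x * qpow q z.
Proof.
case: x z => [a|] [b|] /=; rewrite ?mul0r ?mulr0 //.
by rewrite powRD // (gt_eqF q_gt0) implybT.
Qed.

(** As [q <= 1], [qpow q] reverses the order: minima become maxima and infinity becomes 0. *)
Let fE S : f S = \big[Num.max/0]_(B : {set E} | (#|B| == r) && (S \subset B)) qpow q (nu B).
Proof.
apply: (big_morph (qpow q)) => // x z; rewrite /omin; case: ifP => [xz|nxz].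
  by apply/esym/max_idPl; rewrite qpow_le.
apply/esym/max_idPr; rewrite qpow_le //.
by case: x z nxz => [a|] [b|] //= /negbT; rewrite -ltNge => /ltW.
Qed.

Let f_ge (B S : {set E}) : #|B| = r -> S \subset B -> qpow q (nu B) <= f S.
Proof. by move=> cB SB; rewrite fE le_bigmax_cond // cB eqxx. Qed.

Let f_attained S : f S = 0 \/
  exists B : {set E}, [/\ #|B| = r, S \subset B & f S = qpow q (nu B)].
Proof.
rewrite fE.
apply: (big_ind (fun c => c = 0 \/ exists B : {set E},
  [/\ #|B| = r, S \subset B & c = qpow q (nu B)])) => [|x z hx hz|B /andP[/eqP cB SB]]; first by left.
  by case: leP.
by right; exists B.
Qed.

Let exchange (B1 B2 : {set E}) s : #|B1| = r -> #|B2| = r -> s \in B1 -> s \notin B2 ->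
  exists t, [/\ t \in B2, t \notin B1, #|t |: (B1 :\ s)| = r, #|s |: (B2 :\ t)| = r &
    qpow q (nu B1) * qpow q (nu B2) <=
    qpow q (nu (t |: (B1 :\ s))) * qpow q (nu (s |: (B2 :\ t)))].
Proof.
move=> c1 c2 s1 s2; have [_ [_ /(_ B1 B2 c1 c2 s)]] := vm.
rewrite inE s1 s2 => /(_ isT)[t]; rewrite inE => /andP[t1 t2] h.
exists t; split => //; last by rewrite -!qpowD qpow_le.
  by rewrite cardsU1 !inE (negbTE t1) andbF -c1 (cardsD1 s B1) s1.
by rewrite cardsU1 !inE (negbTE s2) andbF -c2 (cardsD1 t B2) t2.
Qed.

(** Exchange [i] between optimal bases [B1] of [X] and [B2] of [Y]. The element [t] given back lies
    outside [B1], hence outside [Y], so [Y] survives in the new basis. *)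
Let f_move (X Y : {set E}) i : Y \subset X -> i \in X -> f X * f Y <= f (X :\ i) * f (i |: Y).
Proof.
move=> YX iX; have [->|[B1 [c1 XB1 ->]]] := f_attained X.
  by rewrite mul0r mulr_ge0 // qpow_ge0.
have [->|[B2 [c2 YB2 ->]]] := f_attained Y.
  by rewrite mulr0 mulr_ge0 // qpow_ge0.
have [i2|i2] := boolP (i \in B2).
  apply: ler_pM; rewrite ?qpow_ge0 // f_ge //.
    exact: subset_trans (subsetDl _ _) XB1.
  by rewrite subUset sub1set i2.
have [t [t2 t1 c1' c2' h]] := exchange _ _ _ c1 c2 (subsetP XB1 _ iX) i2.
apply: le_trans h _; apply: ler_pM; rewrite ?qpow_ge0 // f_ge //.
  by apply: subset_trans (subsetUr _ _); apply: setSD.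
apply: setUS; apply/subsetD1P; split => //.
by apply: contra t1 => tY; apply/(subsetP XB1)/(subsetP YX).
Qed.

Let f_moveU (X Y : {set E}) i : Y \subset X -> i \notin X ->
  f (i |: X) * f Y <= f X * f (i |: Y).
Proof.
move=> YX iX; rewrite -[f X](congr1 f (setU1K iX)).
by apply: f_move; rewrite ?setU11 // (subset_trans YX) // subsetUr.
Qed.

(** For the triple property, bring [z] into the basis [B1] containing [x] and [y]. If [x] or [y]
    leaves, one of the two alternatives appears directly; otherwise [x], [y], [z] lie in a common
    basis and [fy] moves [y] across. *)
Lemma matroidal_ext : matroidal f.
Proof.
have f_ge0 S : 0 <= f S by apply: qpow_ge0.
have f_anti (S S' : {set E}) : S \subset S' -> f S' <= f S.
  move=> SS'; have [->//|[B [cB S'B ->]]] := f_attained S'.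
  by apply: f_ge => //; apply: subset_trans S'B.
split => //.
- move=> S x f0; apply/eqP; rewrite eq_le f_ge0 andbT -f0.
  exact/f_anti/subsetUr.
- move=> S x y xS yS xy; rewrite mulrC.
  by apply: f_moveU; rewrite ?subsetUr // !inE negb_or eq_sym xy.
move=> S x y z xS yS zS xy xz yz.
have fy : f (x |: (y |: (z |: S))) * f S <= f (z |: (x |: S)) * f (y |: S).
  have -> : x |: (y |: (z |: S)) = y |: (z |: (x |: S)).
    by rewrite setUCA (setUCA [set x]).
  apply: f_moveU; first by rewrite setUA subsetUr.
  by rewrite !inE !negb_or yz yS eq_sym xy.
rewrite le_max; have [->|[B1 [c1 /subsetP XB1 e1]]] := f_attained (y |: (x |: S)).
  by rewrite mul0r mulr_ge0.
have [->|[B2 [c2 /subsetP YB2 e2]]] := f_attained (z |: S).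
  by rewrite mulr0 mulr_ge0.
have SB1 : S \subset B1 by apply/subsetP => u uS; rewrite XB1 // !inE uS !orbT.
have SB2 : S \subset B2 by apply/subsetP => u uS; rewrite YB2 // !inE uS !orbT.
have x1 : x \in B1 by rewrite XB1 // !inE eqxx !orbT.
have y1 : y \in B1 by rewrite XB1 // !inE eqxx.
have z2 : z \in B2 by rewrite YB2 // !inE eqxx.
have close (B B' T T' : {set E}) : #|B| = r -> #|B'| = r -> T \subset B -> T' \subset B' ->
    qpow q (nu B) * qpow q (nu B') <= f T * f T'.
  by move=> *; apply: ler_pM; rewrite ?qpow_ge0 // f_ge.
have [z1|z1] := boolP (z \in B1).
  apply/orP; left; apply: le_trans fy; rewrite e1 e2; apply: close => //.
  by rewrite !subUset !sub1set x1 y1 z1.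
have [t [t1 t2 c2' c1' h]] := exchange _ _ _ c2 c1 z2 z1.
rewrite e1 e2 [qpow q (nu B1) * _]mulrC.
have tS : t \notin S by apply: contra t2; apply/subsetP.
have st (T : {set E}) : T \subset B1 -> t \notin T -> z |: T \subset z |: (B1 :\ t).
  by move=> TB1 tT; apply: setUS; apply/subsetD1P.
have st2 (T : {set E}) : T \subset t |: S -> T \subset t |: (B2 :\ z).
  by move=> TS; apply: subset_trans TS _; apply: setUS; apply/subsetD1P.
have [tx|tx] := eqVneq t x.
  apply/orP; right; apply: le_trans h _; rewrite mulrC; apply: close => //.
    by apply: st; rewrite ?subUset ?sub1set ?y1 // !inE negb_or tS tx xy.
  by apply: st2; rewrite tx.
have [ty|ty] := eqVneq t y.
  apply/orP; left; apply: le_trans h _; rewrite mulrC; apply: close => //.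
    by apply: st; rewrite ?subUset ?sub1set ?x1 // !inE negb_or tS ty eq_sym xy.
  by apply: st2; rewrite ty.
apply/orP; left; apply: le_trans fy; apply: le_trans h _; rewrite mulrC; apply: close => //.
  have -> : x |: (y |: (z |: S)) = z |: (x |: (y |: S)) by rewrite (setUCA [set y]) setUCA.
  by apply: st; rewrite ?subUset ?sub1set ?x1 ?y1 // !inE !negb_or tS tx ty.
by apply: st2; apply: subsetUr.
Qed.

End Valuated.

(** * From pure sums to the weighted counts [Ik] *)

Theorem theoremA (R : realType) (G : {pred R}) (E : finType) (r : nat)
    (nu : {set E} -> option R) (q : R) :
  GRing.zmod_closed G ->
  valuated_matroid G r nu ->
  0 < q -> q <= 1 ->
  forall k : nat, (1 <= k)%N -> (k < r)%N ->
    Ik q r nu k ^+ 2 >=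
      (k.+1)%:R / k%:R * Ik q r nu k.+1 * Ik q r nu k.-1.
Proof.
move=> _ vm q_gt0 q_le1 [//|n] _ _.
have mf := matroidal_ext G r nu q vm q_gt0 q_le1.
have pE m : puresum (fun S => qpow q (ext_nu r nu S)) m set0 = m`!%:R * Ik q r nu m.
  rewrite puresumE // cards0 /Ik; congr (_ * _).
  by apply: eq_bigl => S; rewrite sub0set.
have := puresum_logconcave _ mf n; rewrite !pE !factS !natrM /=.
set a := Ik _ _ _ _; set b := Ik _ _ _ n.+2; set c := Ik _ _ _ n.+1 => h.
have n_gt0 : 0 < n`!%:R :> R by rewrite ltr0n fact_gt0.
have s_gt0 : 0 < n.+1%:R :> R by rewrite ltr0n.
have p_gt0 : 0 < (n.+1%:R * n`!%:R) ^+ 2 :> R by rewrite exprn_gt0 ?mulr_gt0.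
rewrite -(ler_pM2l p_gt0) -exprMn mulrAC; apply: le_trans h.
rewrite le_eqVlt; apply/orP; left; apply/eqP; field.
by rewrite nat1r gt_eqF.
Qed.
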